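(* For every $\epsilon>0$ there exists an infinite primitive sequence of positive integers $q_1<q_2<\cdots$ such that for every $n\ge 2$, \[ q_n-q_{n-1}\le \exp\left(\sqrt{2\log q_n\,\log\log q_n+(2+\epsilon)\log q_n\,\log_3 q_n}\right). \]
   Context: A set (or sequence) of positive integers is called primitive if no element of it divides another element of it. Here $\log$ is the natural logarithm and $\log_3 x=\log\log\log x$ denotes the threefold iterated logarithm. *)

(* Defs.v *)
From HB Require Import structures.
From mathcomp Require Import all_boot all_order all_algebra.
From mathcomp Require Import all_classical all_reals all_analysis.

Set Implicit Arguments.
Unset Strict Implicit.
Unset Printing Implicit Defensive.

Import Order.TTheory GRing.Theory Num.Theory.

Local Open Scope ring_scope.

Definition primitive_sequence (q : nat -> nat) : Prop :=
  (forall i, (0 < q i)%N) /\ (forall i j, i != j -> ~~ (q i %| q j)%N).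

Definition loglog (R : realType) (x : R) : R := ln (ln x).

Definition log3 (R : realType) (x : R) : R := ln (ln (ln x)).

(* [ln] and [Num.sqrt] are total, with value 0 at nonpositive arguments. For an
   integer x >= 3 the three logarithms have positive arguments; the argument of
   the square root is negative only for x below some constant depending on
   [eps], where [gap_bound eps x] is then 1. *)
Definition gap_bound (R : realType) (eps x : R) : R :=
  expR (Num.sqrt (2 * ln x * loglog x + (2 + eps) * ln x * log3 x)).

(* Main.v *)
Require Import Defs.
From HB Require Import structures.
From mathcomp Require Import all_boot all_order all_algebra.
From mathcomp Require Import all_classical all_reals all_analysis.
From mathcomp Require Import zify ring lra.

(* Let p_0 < p_1 < ... be a sparse sequence of primes: p_k is the prime with
   index (k+3)^2, so that the reciprocals of the p_k sum to at most 1/2 while,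
   by Chebyshev's bound, p_k is polynomially bounded in k.  In the dyadic block
   [2^k, 2^(k+1)) keep the integers divisible by p_k but by no p_i with i < k.
   The set kept is primitive: a proper multiple of n in the block of n is
   impossible, and a multiple of n in a later block would be divisible by p_k.
   Among 2k+1 consecutive multiples of p_k, fewer than 2k+1 are divisible by
   some p_i with i < k, so the gaps are bounded by a power of log n, which is
   far below the required bound. *)

Set Implicit Arguments.
Unset Strict Implicit.
Unset Printing Implicit Defensive.

Import Order.TTheory GRing.Theory Num.Theory.

(** * Chebyshev's lower bound for the number of primes, from the central binomial coefficient *)

Lemma exp2_le_central_bin n : 2 ^ n <= 'C(n + n, n).
Proof.
have H m : 2 ^ m * (m`! * m`!) <= (m + m)`!.
  elim: m => [|m IH]; first by [].
  rewrite addnS addSn !factS expnS.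
  have : 2 * (m.+1 * m.+1) * (2 ^ m * (m`! * m`!)) <=
         ((m + m).+2 * (m + m).+1) * (m + m)`!.
    by apply: leq_mul => //; nia.
  by move: (2 ^ m) (m`!) ((m + m)`!) => a b c; nia.
have := H n; rewrite -(@bin_fact (n + n) n) ?leq_addr // addnK.
by rewrite leq_pmul2r // muln_gt0 fact_gt0.
Qed.

(** By Legendre's formula the exponent is the sum over k of floor(2n/p^k) - 2 floor(n/p^k); each
    term is at most 1 and vanishes once p^k > 2n. *)
Lemma logn_central_bin p n : prime p -> 0 < n ->
  logn p 'C(n + n, n) <= trunc_log p (n + n).
Proof.
move=> pp n0; have p1 := prime_gt1 pp.
have : logn p (n + n)`! <= logn p n`! + logn p n`! + trunc_log p (n + n).
  rewrite !logn_fact //.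
  have -> : \sum_(1 <= k < n.+1) n %/ p ^ k = \sum_(1 <= k < (n + n).+1) n %/ p ^ k.
    rewrite [RHS](@big_cat_nat _ _ _ n.+1) //=; last by lia.
    rewrite [X in _ = _ + X]big_nat_cond [X in _ = _ + X]big1 ?addn0 // => k.
    rewrite andbT => /andP[nk _].
    by rewrite divn_small //; apply: leq_trans (ltn_expl k p1); lia.
  set T := trunc_log _ _.
  (* Writing [T] as a sum of indicators over the same range lets the bound be checked term by
     term. *)
  have -> : T = \sum_(1 <= k < (n + n).+1) (k <= T).
    have TN : T <= n + n.
      by rewrite (leq_trans (ltnW (ltn_expl T p1))) // trunc_logP //; lia.
    rewrite (@big_cat_nat _ _ _ T.+1) //=.
    rewrite [X in _ = _ + X]big_nat_cond [X in _ = _ + X]big1 ?addn0; last first.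
      by move=> k; rewrite andbT => /andP[Tk _]; rewrite leqNgt Tk.
    rewrite big_nat_cond (eq_bigr (fun=> 1)); last first.
      by move=> k; rewrite andbT ltnS => /andP[_ ->].
    by rewrite -big_nat_cond sum_nat_const_nat muln1 subn1.
  rewrite -!big_split /=; apply: leq_sum => k _.
  case: (leqP k T) => [_|Tk]; first by exact: (leq_divDl (p ^ k) n n).
  rewrite divn_small //; apply: leq_trans (trunc_log_ltn _ p1) _.
  exact: leq_pexp2l (ltnW p1) Tk.
rewrite -(@bin_fact (n + n) n) ?leq_addr // addnK.
by rewrite !lognM ?muln_gt0 ?fact_gt0 ?bin_gt0 ?leq_addr //; lia.
Qed.

(** The central binomial coefficient is a product of prime powers, each at most 2n, over the primes
    up to 2n. *)
Lemma exp2_le_prime_count n : 0 < n ->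
  2 ^ n <= (n + n) ^ count prime (iota 0 (n + n).+1).
Proof.
move=> n0; apply: leq_trans (exp2_le_central_bin n) _.
set C := 'C(_, _); have C0 : 0 < C by rewrite bin_gt0 leq_addr.
rewrite -{1}(partnT C0) /partn.
rewrite big_mkcond (eq_bigr (fun p => p ^ logn p C)) //.
have le p : p ^ logn p C <= if prime p && (p <= n + n) then n + n else 1.
  case: ifP => [/andP[pp _]|].
    apply: leq_trans (trunc_logP (prime_gt1 pp) _); last by lia.
    by rewrite leq_exp2l ?prime_gt1 // logn_central_bin.
  case: (boolP (prime p)) => [pp /= /negbT pn|npp _]; last first.
    by rewrite lognE (negbTE npp).
  suff: logn p C <= 0 by rewrite leqn0 => /eqP ->.
  apply: leq_trans (logn_central_bin pp n0) _.
  by rewrite leqNgt trunc_log_gt0 negb_and -leqNgt; apply/orP; right; lia.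
apply: (@leq_trans (\prod_(0 <= p < C.+1) if prime p && (p <= n + n) then n + n else 1)).
  exact: leq_prod.
rewrite -big_mkcond /= -big_filter /index_iota subn0.
rewrite big_const_seq count_predT iter_muln_1 leq_pexp2l //; first by lia.
rewrite -size_filter; apply: uniq_leq_size; first exact/filter_uniq/iota_uniq.
by move=> p; rewrite !mem_filter !mem_iota /= !ltnS => /andP[/andP[pp ->] _]; rewrite pp prime_gt0.
Qed.

(** * Enumeration of the primes and a quadratic upper bound for its terms *)

Fixpoint nth_prime (n : nat) : nat :=
  if n is m.+1 then
    ex_minn (let: exist2 p lt_p pr_p := prime_above (nth_prime m) in
             ex_intro (fun p => (nth_prime m < p) && prime p) p (introT andP (conj lt_p pr_p)))
  else 2.

Lemma nth_primeS n :
  [/\ nth_prime n < nth_prime n.+1, prime (nth_prime n.+1) &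
      forall p, nth_prime n < p -> prime p -> nth_prime n.+1 <= p].
Proof.
rewrite [nth_prime n.+1]/=; case: ex_minnP => p /andP[np pp] pmin.
by split=> // q nq pq; apply: pmin; rewrite nq.
Qed.

Lemma prime_nth_prime n : prime (nth_prime n).
Proof. by case: n => // n; case: (nth_primeS n). Qed.

Lemma ltn_nth_prime : {homo nth_prime : m n / m < n}.
Proof. by apply: homo_ltn => [y x z|n]; [exact: ltn_trans | case: (nth_primeS n)]. Qed.

Lemma nth_prime_inj : injective nth_prime.
Proof.
by move=> m n mn; case: (ltngtP m n) => // /ltn_nth_prime; rewrite mn ltnn.
Qed.

Lemma leq_nth_prime n : n <= nth_prime n.
Proof.
by elim: n => // n IH; case: (nth_primeS n) => lt _ _; apply: leq_ltn_trans lt.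
Qed.

Lemma count_prime_nth_prime n : count prime (iota 0 (nth_prime n)) <= n.
Proof.
elim: n => // n IH; have [] := nth_primeS n; move: (nth_prime n.+1) => q lt _ qmin.
have -> : q = nth_prime n + (q - nth_prime n).-1.+1 by lia.
rewrite iotaD count_cat add0n /= prime_nth_prime -[n.+1]addn1 leq_add //.
rewrite add1n ltnS leqNgt -has_count.
apply/hasPn => p; rewrite mem_iota => /andP[np pn].
by apply/negP => pp; have := qmin p np pp; lia.
Qed.

(** Let 2^s <= n+1 < 2^(s+1) and t = 2s+4. If the prime exceeded 2^(t+1), at most n primes would lie
    below that power, and Chebyshev's bound would give 2^t <= (t+1)n. *)
Lemma nth_prime_le_sqr n : nth_prime n <= 32 * n.+1 ^ 2.
Proof.
set s := trunc_log 2 n.+1.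
have /andP[sn ns] : 2 ^ s <= n.+1 < 2 ^ s.+1 by exact: trunc_log_bounds.
have -> : 32 * n.+1 ^ 2 = 32 * (n.+1 * n.+1) by [].
have -> : 32 * (n.+1 * n.+1) = 2 * (16 * (n.+1 * n.+1)) by lia.
set t := s + s + 4.
have tE : 2 ^ t = 16 * (2 ^ s * 2 ^ s) by rewrite /t !expnD mulnC.
suff : nth_prime n <= 2 ^ t + 2 ^ t by rewrite tE; move: sn; move: (2 ^ s) => a; nia.
rewrite leqNgt; apply/negP => lt.
have := @exp2_le_prime_count (2 ^ t) (expn_gt0 2 t).
have c_le : count prime (iota 0 (2 ^ t + 2 ^ t).+1) <= n.
  apply: leq_trans (count_prime_nth_prime n).
  rewrite -(subnKC lt) iotaD count_cat; exact: leq_addr.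
have -> : 2 ^ t + 2 ^ t = 2 ^ t.+1 by rewrite expnS; lia.
rewrite -expnM leq_exp2l // leqNgt => /negP; apply.
have {}c_le : t.+1 * count prime (iota 0 (2 ^ t.+1).+1) <= t.+1 * n.
  by move: c_le; rewrite leq_mul2l expnS mul2n addnn => ->.
apply: leq_ltn_trans c_le _; rewrite tE.
have := ltn_expl s (isT : 1 < 2); move: sn ns; rewrite expnS /t.
move: (2 ^ s) => a sn ns sa.
(* With a = 2^s > s, the factor t+1 = 2s+5 is at most 2a+3 and n < 2a, so the product stays below
   16a^2 = 2^t. *)
apply: (@leq_ltn_trans ((2 * a + 3) * (2 * a))); last by nia.
by apply: leq_mul; lia.
Qed.

(** * Sieving an interval by a union bound *)

Lemma count_dvdn d a M : 0 < d ->
  a %/ d + count (dvdn d) (iota a.+1 M) = (a + M) %/ d.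
Proof.
move=> d0; elim: M a => [|M IH] a; first by rewrite !addn0.
by rewrite /= addnA -addSnnS -IH divnS // [a %/ d + _]addnC.
Qed.

Lemma count_dvdn_le d a M : 0 < d -> count (dvdn d) (iota a.+1 M) <= M %/ d + 1.
Proof.
move=> d0; rewrite -(leq_add2l (a %/ d)) count_dvdn // addnA.
exact: leq_divDl.
Qed.

(** Among M consecutive integers at most M/d + 1 are multiples of d; if these counts sum to less
    than M, some integer escapes them all. *)
Lemma exists_unsieved (d : nat -> nat) k a M : (forall i, i < k -> 0 < d i) ->
  \sum_(i < k) (M %/ d i + 1) < M ->
  exists2 m, a < m <= a + M & forall i, i < k -> ~~ (d i %| m).
Proof.
move=> d0 sumM.
have : count (fun m => has (fun i => d i %| m) (iota 0 k)) (iota a.+1 M) < M.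
  apply: leq_ltn_trans sumM; elim: k d0 => [|k IH] d0.
    by rewrite big_ord0 /= count_pred0.
  have -> : iota 0 k.+1 = iota 0 k ++ [:: k] by rewrite -addn1 iotaD.
  rewrite big_ord_recr /=.
  apply: (@leq_trans (count (fun m => has (fun i => d i %| m) (iota 0 k)) (iota a.+1 M) +
                      count (dvdn (d k)) (iota a.+1 M))).
    rewrite -count_predUI; apply: leq_trans (leq_addr _ _).
    by apply: sub_count => m /=; rewrite has_cat /= orbF.
  apply: leq_add; last exact/count_dvdn_le/d0.
  by apply: IH => i ik; apply: d0; apply: ltnW.
rewrite -{2}(size_iota a.+1 M) -(count_predC (fun m => has (fun i => d i %| m) (iota 0 k))).
rewrite -[X in X < _]addn0 ltn_add2l -has_count => /hasP[m].
rewrite mem_iota /= addSn ltnS => mM /hasPn nd; exists m => // i ik.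
by apply: nd; rewrite mem_iota.
Qed.

(** * The primitive set built on dyadic blocks, and its gaps *)

Definition block_prime k := nth_prime ((k + 3) ^ 2).

Lemma prime_block_prime k : prime (block_prime k). Proof. exact: prime_nth_prime. Qed.

Lemma block_prime_inj : injective block_prime.
Proof. by move=> i j /nth_prime_inj /eqP; rewrite eqn_sqr eqn_add2r => /eqP. Qed.

(* The telescoping sum of 1/((i+2)(i+3)), multiplied out. *)
Lemma sum_div_block_prime k M : 2 * (k + 2) * \sum_(i < k) M %/ block_prime i <= M * k.
Proof.
elim: k => [|k IH]; first by rewrite big_ord0 muln0.
rewrite big_ord_recr /=; set S := \sum_(i < k) _ in IH *; set q := M %/ _.
have qM : q * ((k + 3) * (k + 3)) <= M.
  apply: leq_trans (leq_divM M (block_prime k)).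
  by rewrite leq_mul2l (leq_nth_prime ((k + 3) ^ 2)) orbT.
(* After this multiplication the step rests on k(k+3) + 2 = (k+1)(k+2). *)
rewrite -(@leq_pmul2r (k + 2)) ?addn2 //; clearbody S q.
rewrite addn2 in IH.
have h1 := leq_mul (leqnn (k + 3)) IH.
have h2 : 2 * (k + 3) * k.+2 * q <= 2 * M.
  by apply: leq_trans (leq_mul (leqnn 2) qM); nia.
by nia.
Qed.

Definition kept n :=
  let k := trunc_log 2 n in
  [&& 0 < n, block_prime k %| n & all (fun i => ~~ (block_prime i %| n)) (iota 0 k)].

Lemma kept_antichain m n : kept m -> kept n -> m %| n -> m = n.
Proof.
case/and3P=> m0 dm _ /and3P[n0 _ /allP dn] mn.
have le := dvdn_leq n0 mn.
case: (ltngtP (trunc_log 2 m) (trunc_log 2 n)) => [lt|gt|eq].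
- have := dn (trunc_log 2 m); rewrite mem_iota => /(_ lt).
  by rewrite (dvdn_trans dm mn).
- by have := leq_trunc_log 2 le; rewrite leqNgt gt.
have /andP[m1 m2] := @trunc_log_bounds 2 m isT m0.
have /andP[n1 n2] := @trunc_log_bounds 2 n isT n0.
(* Both lie in one dyadic block, so a quotient of 2 or more would push [n] out of it. *)
rewrite /= eq in m1 m2 n1 n2; case/dvdnP: mn n2 => -[|[|c]] eqn; rewrite eqn in n0 *.
- by [].
- by rewrite mul1n.
by rewrite -eqn expnS; move: m1; move: (2 ^ _) => a; nia.
Qed.

Definition block_gap k := block_prime k * (2 * k + 1).

(** The sieve is applied to the cofactors m of the 2k+1 multiples of p_k following y; the second
    hypothesis keeps all of these in block k. An index i < k gives a prime distinct from p_k, so it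
    divides p_k m only if it divides m. *)
Lemma kept_in_block k y : 2 ^ k <= y -> y + block_gap k < 2 ^ k.+1 ->
  exists2 n, kept n & y < n <= y + block_gap k.
Proof.
move=> yk ky; set p := block_prime k; have p0 : 0 < p by rewrite prime_gt0 ?prime_block_prime.
have [||m /andP[m1 m2] dm] := @exists_unsieved block_prime k (y %/ p) (2 * k + 1).
- by move=> i _; rewrite prime_gt0 ?prime_block_prime.
(* The sieve total is at most (2k+1)k/(2(k+2)) + k, which is less than 2k+1. *)
- rewrite big_split /= sum1_card card_ord; have := sum_div_block_prime k (2 * k + 1).
  by move: (\sum_(i < k) _) => S; nia.
have n1 : y < p * m by rewrite mulnC -ltn_divLR.
have n2 : p * m <= y + block_gap k.
  apply: (leq_trans (leq_mul (leqnn p) m2)).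
  by rewrite mulnDr leq_add2r mulnC leq_divM.
exists (p * m); last by rewrite n1.
have logE : trunc_log 2 (p * m) = k.
  by apply: trunc_log_eq => //; rewrite (leq_trans yk (ltnW n1)) (leq_ltn_trans n2).
apply/and3P; split; rewrite ?logE ?dvdn_mulr //; first exact: leq_ltn_trans n1.
apply/allP => i; rewrite mem_iota add0n => /= ik.
rewrite Euclid_dvdM ?prime_block_prime // negb_or dm // andbT.
rewrite dvdn_prime2 ?prime_block_prime //.
by apply: contraTneq ik => /block_prime_inj ->; rewrite ltnn.
Qed.

(** The quadratic bound gives p_k <= 32(k+6)^4, and 32(2k+1) < (k+6)^2 for such k. *)
Lemma block_gap_lt_pow k : 58 <= k -> block_gap k < (k + 6) ^ 6.
Proof.
move=> k58; have := nth_prime_le_sqr ((k + 3) ^ 2); rewrite -/(block_prime k) /block_gap.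
move: (block_prime k) => p pk.
have h1 : ((k + 3) ^ 2).+1 <= (k + 6) ^ 2 by rewrite !expnS !expn0; nia.
have h2 : p <= 32 * (k + 6) ^ 4.
  by apply: (leq_trans pk); rewrite leq_mul2l /= (expnM _ 2 2) leq_sqr.
apply: (@leq_ltn_trans (32 * (k + 6) ^ 4 * (2 * k + 1))); first by rewrite leq_mul2r h2 orbT.
rewrite (expnD _ 2 4); have : 0 < (k + 6) ^ 4 by rewrite expn_gt0 addnS.
by move: ((k + 6) ^ 4) => a a0; rewrite !expnS expn0; nia.
Qed.

(** With D = 2(C+1) and s = floor(u/D) >= D, one has u <= (s+1)^2 <= 4^s, hence u^C <= 2^(2sC) <
    2^(sD) <= 2^u. *)
Lemma pow_lt_exp2 C u : (2 * C.+1) ^ 2 <= u -> u ^ C < 2 ^ u.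
Proof.
move=> Cu; set D := 2 * C.+1; have D0 : 0 < D by [].
set s := u %/ D; have us : u < s.+1 * D by rewrite -ltn_divLR.
have Ds : D <= s by rewrite leq_divRL // -/(D ^ 2).
have s1 : s.+1 <= 2 ^ s by exact: ltn_expl.
have us2 : u <= (2 ^ s) ^ 2.
  rewrite -leq_sqr in s1; apply: leq_trans s1.
  by apply: (leq_trans (ltnW us)); rewrite -mulnn leq_mul2l /=; lia.
have sD : s * D <= u by exact: leq_divM.
apply: (@leq_ltn_trans (((2 ^ s) ^ 2) ^ C)); first by case: (C) => // c; rewrite leq_exp2r.
by rewrite -!expnM ltn_exp2l //; move: sD; rewrite /D; nia.
Qed.

(** If the block of x has too little room left above x, the search restarts at the next power of
    two; the two gap lengths together still fit in the stated bound. *)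
Lemma kept_after K x : 250 <= K -> 2 ^ K <= x ->
  exists2 n, kept n & x < n <= x + (trunc_log 2 x + 7) ^ 7.
Proof.
move=> K250 x0; have x1 : 0 < x by apply: leq_trans x0; rewrite expn_gt0.
have k250 : 250 <= trunc_log 2 x.
  by apply: (leq_trans K250); rewrite -[K in K <= _](@trunc_expnK 2) // leq_trunc_log.
have /andP[] := @trunc_log_bounds 2 x isT x1.
move: (trunc_log 2 x) k250 => k k250 kx xk; clear K K250 x0.
have g1 := @block_gap_lt_pow k ltac:(lia); have g2 := @block_gap_lt_pow k.+1 ltac:(lia).
(* Block k+1 is longer than its gap bound: (k+7)^7 < 2^(k+7) = 64 * 2^(k+1), and k+7 >= 64. Exponent
   7 requires k+7 >= 16^2 = 256, which 250 <= k ensures. *)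
have lt2 : (k.+1 + 6) ^ 6 < 2 ^ k.+1.
  have := @pow_lt_exp2 7 (k.+1 + 6) ltac:(rewrite -mulnn; lia).
  rewrite (expnD _ 6 1) (expnD 2 k.+1 6) expn1.
  by move: (_ ^ 6) (2 ^ k.+1) => a b; rewrite -[2 ^ 6]/64; nia.
have le12 : (k + 6) ^ 6 <= (k.+1 + 6) ^ 6 by rewrite leq_exp2r // leq_add2r.
have G : block_gap k + block_gap k.+1 <= (k + 7) ^ 7.
  apply: (@leq_trans (2 * (k.+1 + 6) ^ 6)); first by lia.
  have -> : k.+1 + 6 = k + 7 by lia.
  by rewrite (expnD _ 6 1) expn1 mulnC leq_mul2l; lia.
case: (ltnP (x + block_gap k) (2 ^ k.+1)) => cmp.
  have [n gn /andP[n1 n2]] := kept_in_block kx cmp.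
  by exists n => //; rewrite n1 (leq_trans n2) // leq_add2l (leq_trans _ G) ?leq_addr.
have [|n gn /andP[n1 n2]] := @kept_in_block k.+1 (2 ^ k.+1) (leqnn _).
  by rewrite [2 ^ k.+2]expnS mul2n -addnn ltn_add2l; lia.
exists n => //; rewrite (ltn_trans xk n1) (leq_trans n2) //.
by apply: (@leq_trans (x + (block_gap k + block_gap k.+1))); lia.
Qed.

(** * Comparison of a power of the logarithm with the required bound, and the final sequence *)

Local Open Scope ring_scope.

(** With L = ln y and l = ln L, the claim reduces to (C l)^2 <= 2 L l, the [log3] term being
    nonnegative. The choice of [A] forces l >= 4C^2 + 1, and then 4 C^2 l <= l^2 <= 4L. *)
Lemma pow_ln_le_gap_bound (R : realType) (eps : R) (C : nat) : 0 < eps ->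
  exists2 A : R, 1 <= A & forall y : R, A <= ln y -> ln y ^+ C <= gap_bound eps y.
Proof.
move=> eps0; set c : R := C%:R; have c0 : 0 <= c by exact: ler0n.
exists (expR (4 * c ^+ 2 + 1)).
  by apply: le_trans (expR_ge1Dx _); have := sqr_ge0 c; lra.
move=> y; set L := ln y => AL; have L0 : 0 < L := lt_le_trans (expR_gt0 _) AL.
rewrite -[L in L ^+ C]lnK ?posrE // -expRM_natl -/c /gap_bound ler_expR.
set l := ln L.
have cl : 4 * c ^+ 2 + 1 <= l by rewrite -(expRK (4 * c ^+ 2 + 1)) ler_ln ?posrE ?expR_gt0.
have l1 : 1 <= l by have := sqr_ge0 c; lra.
have ll0 : 0 <= ln l by exact: ln_ge0.
(* From L = exp(l/2)^2 and exp(l/2) >= 1 + l/2. *)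
have lL : l ^+ 2 <= 4 * L.
  have -> : L = expR (l / 2) ^+ 2 by rewrite -expRM_natl mulrCA divff ?mulr1 ?lnK ?posrE // pnatr_eq0.
  have := expR_ge1Dx (l / 2); move: (expR _) => e; nra.
have cl0 : 0 <= c * l by apply: mulr_ge0 => //; lra.
rewrite /loglog /log3 -/L -/l -(ger0_norm cl0) -sqrtr_sqr ler_sqrt.
  have h1 : (c * l) ^+ 2 <= 2 * L * l.
    have : 4 * c ^+ 2 * l <= l ^+ 2 by nra.
    by move=> h; have : c ^+ 2 * l <= L by [lra]; rewrite exprMn; nra.
  by apply: (le_trans h1); rewrite lerDl !mulr_ge0 //; lra.
by rewrite addr_ge0 // !mulr_ge0 //; lra.
Qed.

(** This is ln(1 + x) <= x at x = -1/2. *)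
Lemma half_le_ln2 (R : realType) : 2^-1 <= ln (2 : R).
Proof.
have := @le_ln1Dx R (- 2^-1); rewrite (_ : 1 + - 2^-1 = 2^-1 :> R); last by lra.
by rewrite lnV ?posrE // lerN2; apply; lra.
Qed.

Lemma half_trunc_log2_le_ln (R : realType) (x y : nat) : (0 < x <= y)%N ->
  (trunc_log 2 x)%:R / 2 <= ln (y%:R : R).
Proof.
move=> /andP[x0 xy]; have le : (2 ^ trunc_log 2 x <= y)%N.
  by apply: leq_trans xy; apply: trunc_logP.
apply: (@le_trans _ _ (ln ((2 ^ trunc_log 2 x)%:R : R))).
  rewrite natrX lnXn // -[ln _ *+ _]mulr_natl ler_wpM2l ?ler0n //; exact: half_le_ln2.
by rewrite ler_ln ?posrE ?ltr0n ?expn_gt0 ?ler_nat // (leq_trans x0 xy).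
Qed.

(* Indices start at 0: [q n] is the (n+1)-st term of the sequence. *)
Theorem theorem1p1 (R : realType) (eps : R) (heps : 0 < eps) :
  exists q : nat -> nat,
    [/\ primitive_sequence q,
        {homo q : m n / (m < n)%N} &
        forall n : nat,
          (q n.+1)%:R - (q n)%:R <= gap_bound eps (q n.+1)%:R].
Proof.
(* The exponent is 14 = 2 * 7: gaps are at most (k+7)^7, and k+7 <= 2L+7 <= L^2 for L = ln
   q_(n+1). *)
have [A A1 gapA] := @pow_ln_le_gap_bound R eps 14 heps.
(* Since L >= k/2 >= K/2, this choice yields both L >= 125 and L >= [A]. *)
set K := (250 + 2 * Num.bound A)%N.
have /boolp.choice[f fP] : forall x, exists y, (2 ^ K <= x)%N ->
    kept y /\ (x < y <= x + (trunc_log 2 x + 7) ^ 7)%N.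
  move=> x.
  (* The value 0 below 2^K is a dummy that makes [f] total. *)
  case: (boolP (2 ^ K <= x)%N) => [xK|_]; last by exists 0%N.
  by have [y gy xy] := kept_after (leq_addr _ _) xK; exists y.
(* The iteration count is n+1 so that every term, including the first, is a value of [f] and hence
   kept. *)
pose q n := iter n.+1 f (2 ^ K)%N.
have itK n : (2 ^ K <= iter n f (2 ^ K))%N.
  by elim: n => //= n IH; have [_ /andP[lt _]] := fP _ IH; rewrite ltnW ?(leq_ltn_trans IH).
have gq n : kept (q n) by case: (fP _ (itK n)).
have ltq n : (q n < q n.+1 <= q n + (trunc_log 2 (q n) + 7) ^ 7)%N.
  by case: (fP _ (itK n.+1)).
have homoq : {homo q : m n / (m < n)%N}.
  by apply: homo_ltn => [y x z|n]; [exact: ltn_trans | case/andP: (ltq n)].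
exists q; split => //.
  split=> [i|i j]; first by case/and3P: (gq i).
  apply: contraNN => /(kept_antichain (gq i) (gq j)) qij.
  by case: (ltngtP i j) => // /homoq; rewrite qij ltnn.
move=> n; have /andP[lt le] := ltq n; set L := ln ((q n.+1)%:R : R).
have q0 : (0 < q n)%N by case/and3P: (gq n).
have kL : (trunc_log 2 (q n))%:R / 2 <= L.
  by apply: half_trunc_log2_le_ln; rewrite q0 ltnW.
have kK : (K <= trunc_log 2 (q n))%N.
  by rewrite -[K in (K <= _)%N](@trunc_expnK 2) // leq_trunc_log // itK.
move: (trunc_log 2 (q n)) kL kK le => k kL kK le.
have KR : K%:R <= k%:R :> R by rewrite ler_nat.
have KE : K%:R = 250 + 2 * (Num.bound A)%:R :> R by rewrite natrD natrM.
have AB : A <= (Num.bound A)%:R.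
  by apply/ltW; apply: le_lt_trans (archi_boundP _); lra.
apply: le_trans (gapA _ _); last by rewrite -/L; lra.
rewrite lerBlDl; apply: (@le_trans _ _ (q n + (k + 7) ^ 7)%N%:R); first by rewrite ler_nat.
rewrite natrD lerD2l natrX (exprM _ 2 7) lerXn2r ?nnegrE ?ler0n ?sqr_ge0 //.
rewrite natrD -/L; have L125 : 125 <= L by lra.
have : 125 * L <= L ^+ 2 by rewrite expr2 ler_wpM2r //; lra.
by lra.
Qed.
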